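(* Let $X$ be a rectifiable $T_0$-space (equivalently, a regular rectifiable space) with the strong Pytkeev property. A countably compact subspace $K$ of $X$ is metrizable if and only if $K\times K$ has countable fan open-tightness at each point of the diagonal $\Delta_K=\{(x,y)\in K\times K:x=y\}$.
   Context: A subset $A$ of a topological space $X$ accumulates at a point $x\in X$ if each neighborhood of $x$ contains infinitely many points of $A$. A topological space $X$ has the strong Pytkeev property at a point $x\in X$ if there is a countable family $\mathcal N$ of subsets of $X$ such that for every neighborhood $O_x\subset X$ of $x$ and every subset $A\subset X$ accumulating at $x$ there is a set $N\in\mathcal N$ such that $N\subset O_x$ and $N\cap A$ is infinite. $X$ has the strong Pytkeev property if it has it at each point $x\in X$. A topological space $X$ is rectifiable if there are a point $e\in X$ and a homeomorphism $H:X^2\to X^2$ such that $H(x,e)=(x,x)$ and $H(\{x\}\times X)=\{x\}\times X$ for every $x\in X$. A space $K$ is countably compact if each infinite subset of $K$ has an accumulation point in $K$. A topological space $Z$ has countable fan open-tightness at a point $z\in Z$ if for every sequence of open sets $A_n\subset Z$, $n\in\omega$, with $z\in\bigcap_{n\in\omega}\overline{A_n}$ there are finite sets $F_n\subset A_n$, $n\in\omega$, such that each neighborhood of $z$ meets infinitely many of the sets $F_n$. *)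

(* Defs.v *)
From HB Require Import structures.
From mathcomp Require Import all_boot all_order all_algebra.
From mathcomp Require Import all_classical all_reals.
From mathcomp Require Import topology.

Set Implicit Arguments.
Unset Strict Implicit.
Unset Printing Implicit Defensive.

Local Open Scope classical_set_scope.

Definition accumulation_point (T : topologicalType) (A : set T) (x : T) : Prop :=
  forall U : set T, nbhs x U -> infinite_set (U `&` A).

Definition strong_pytkeev_at (T : topologicalType) (x : T) : Prop :=
  exists N : set (set T), countable N /\
    forall O A : set T, nbhs x O -> accumulation_point A x ->
      exists M : set T, [/\ N M, M `<=` O & infinite_set (M `&` A)].

Definition strong_pytkeev (T : topologicalType) : Prop :=
  forall x : T, strong_pytkeev_at x.

Definition homeomorphism (T U : topologicalType) (f : T -> U) : Prop :=
  continuous f /\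
  exists g : U -> T, [/\ cancel f g, cancel g f & continuous g].

Definition rectifiable (T : topologicalType) : Prop :=
  exists (e : T) (H : T * T -> T * T),
    [/\ homeomorphism H,
        forall x : T, H (x, e) = (x, x)
      & forall x : T, H @` ([set x] `*` setT) = [set x] `*` setT].

Definition countably_compact (T : topologicalType) : Prop :=
  forall A : set T, infinite_set A -> exists x : T, accumulation_point A x.

(* Infinitely many is counted by the index n, not by distinct sets F n:
   otherwise every isolated point would fail the property. *)
Definition countable_fan_open_tightness_at (T : topologicalType) (z : T) :
    Prop :=
  forall A : nat -> set T,
    (forall n, open (A n)) -> (forall n, closure (A n) z) ->
    exists F : nat -> set T,
      (forall n, finite_set (F n) /\ F n `<=` A n) /\
      forall U : set T, nbhs z U -> infinite_set [set n | F n `&` U !=set0].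

(* A metricType carries its own uniformity and ball structure, so a metric
   compatible with the topology of T is expressed by a homeomorphism. *)
Definition metrizable (R : realType) (T : topologicalType) : Prop :=
  exists (M : metricType R) (f : T -> M), homeomorphism f.

(* Main.v *)
Require Import Defs.
From HB Require Import structures.
From mathcomp Require Import all_boot all_order all_algebra.
From mathcomp Require Import all_classical all_reals.
From mathcomp Require Import topology normedtype.

(** Write the rectification as [H (x, y) = (x, h (x, y))] and let [q (x, y)] be
    the second component of [H^-1 (x, y)]; in a topological group these are
    [x * y] and [x^-1 * y].  So [q] is a continuous division: [q (x, x) = e],
    [h (x, q (x, y)) = y] and [h (x, e) = x].  The preimages under [q] of the
    neighbourhoods of [e] play the role of entourages, and division also turns
    T0 into T1 ([division_accessible]) and gives regularity at [e]
    ([division_regular]).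

    Suppose [K * K] has countable fan open-tightness along the diagonal, and let
    [N 0, N 1, ...] be a Pytkeev family at [e].  For a neighbourhood [O] of [e]
    let [U n] be the union of [{e}] and of the [N k] with [k < n] contained in
    [O].  If no closure of [q^-1 (U n)] were a neighbourhood of [(x, x)], fan
    open-tightness applied to the complements of these closures would give
    finite sets [F n] avoiding [q^-1 (U n)] whose [q]-images accumulate at [e].
    Some [N k] inside [O] would contain infinitely many points of these images;
    but for [n > k] it is part of [U n], which the image of [F n] avoids
    ([fan_open_tight_closure]).  As the [U n] increase, countable compactness
    makes one [n] work at every point of the diagonal
    ([countably_compact_diagonal_closure]).  Since [U n] is given by a finite
    set of indices, only countably many sets [closure (q^-1 (U n))] arise as [O]
    varies, and by regularity one of them lies in each [q^-1 O].

    So the diagonal of [K] has countably many neighbourhoods whose sections form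
    neighbourhood bases and the intersection of whose closures is the diagonal.
    On a countably compact space the finite intersections of such neighbourhoods
    form a base of a uniformity ([diagonal_sequence_base]): otherwise there are
    sequences violating the composition axiom, and subsequences of them converge
    to one and the same point.  A Hausdorff uniformity with a countable base is
    metrizable ([countable_uniform_metrizable]).

    Conversely, a metrizable space is first countable, hence so is its square,
    and at a point with a countable neighbourhood base it suffices to pick one
    point of the [n]-th given open set in the [n]-th basic neighbourhood. *)

Set Implicit Arguments.
Unset Strict Implicit.
Unset Printing Implicit Defensive.

Import Order.TTheory GRing.Theory Num.Theory.

Local Open Scope classical_set_scope.

(** * Metrization of countable uniformities *)

(** A countable uniformity comes from a pseudometric, given by its balls only;
    the distance is recovered as an infimum of radii, which is finite because
    all balls of radius 2 are the whole space. *)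
Lemma countable_uniform_metrizable (R : realType) (T : uniformType) :
  countable_uniformity T -> hausdorff_space T -> metrizable R T.
Proof.
move=> cntT hT.
pose P : pseudoMetricType R := countable_uniform.type cntT.
pose d (x y : P) : R := fine (edist (x, y)).
have dE x y : (d x y)%:E = edist (x, y).
  rewrite fineK//; apply/edist_finP; exists 2%R => //.
  exact: countable_uniform.countable_uniform_bounded.
have dxx x : d x x = 0%R by rewrite /d edist_refl.
have dpos x y : d x y = 0%R -> x = y.
  move=> d0; have : edist (x, y) = 0%E by rewrite -dE d0.
  by move=> /edist_closeP; rewrite closeEnbhs => xy; exact: hT.
have dsym x y : d x y = d y x by rewrite /d edist_sym.
have dtri y x z : (d x z <= d x y + d y z)%R.
  by rewrite -lee_fin EFinD !dE; exact: edist_triangle.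
have d_ball (x y : P) r : (d x y < r)%R -> ball x r y.
  by rewrite -lte_fin dE => /edist_lt_ball.
have ball_d (x y : P) r : (0 < r)%R -> ball x r y -> (d x y <= r)%R.
  by move=> r0 xy; rewrite -lee_fin dE; exact: edist_fin.
pose M : metricType R := HB.pack_for (metricType R) (T : choiceType)
  (isMetric.Build R T dxx dpos dsym dtri).
have nbhsE (x : T) (U : set T) : @nbhs M M x U <-> nbhs x U.
  have -> : nbhs x U = @nbhs P P x U by [].
  have mdE y z : @mdist R M y z = d y z by [].
  (* Membership in [ball x r] only gives [d x y <= r], hence the halved
     radius. *)
  split => [/(@nbhs_ballP R M)|/(@nbhs_ballP R P)][r /= r0 rU].
    apply/(@nbhs_ballP R P).
    exists (r / 2)%R => /=; first by rewrite divr_gt0.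
    move=> y /ball_d xy; apply: rU; rewrite ballEmdist /= mdE.
    by rewrite (le_lt_trans (xy _)) ?divr_gt0// ltr_pdivrMr// ltr_pMr// ltr1n.
  apply/(@nbhs_ballP R M); exists r => // y; rewrite ballEmdist /= mdE => xy.
  exact/rU/d_ball.
exists M, (id : T -> M); split; first by move=> x U /nbhsE.
by exists (id : M -> T); split => // x U /nbhsE.
Qed.

(** The hypotheses say that [G] is a base of a uniformity inducing the topology
    of [T]. *)
Lemma diagonal_sequence_metrizable (R : realType) (T : topologicalType)
    (G : nat -> set (T * T)) :
  (forall n x, nbhs x [set y | G n (x, y)]) ->
  (forall x U, nbhs x U -> exists n, forall y, G n (x, y) -> U y) ->
  (forall m n, (m <= n)%N -> G n `<=` G m) ->
  (forall n, exists m, forall x y, G m (x, y) -> G n (y, x)) ->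
  (forall n, exists m, forall x y z, G m (x, y) -> G m (y, z) -> G n (x, z)) ->
  hausdorff_space T -> metrizable R T.
Proof.
move=> Gx Gbase Gle Gsym Gcomp hT.
pose ent := filter_from [set: nat] G.
have ent_filter : Filter ent.
  apply: filter_from_filter; first by exists 0.
  move=> i j _ _; exists (maxn i j) => // xy Gxy.
  by split; apply: Gle Gxy; rewrite ?leq_maxl ?leq_maxr.
have ent_diag A : ent A -> diagonal `<=` A.
  move=> [n _ GA] [x y] /diagonalP <-; apply: GA.
  exact: nbhs_singleton (Gx n x).
have ent_inv A : ent A -> ent (A^-1)%relation.
  move=> [n _ GA]; have [m Gm] := Gsym n; exists m => // -[x y] /Gm.
  exact: GA.
have ent_split A : ent A -> exists2 B, ent B & (B \; B `<=` A)%relation.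
  move=> [n _ GA]; have [m Gm] := Gcomp n; exists (G m); first by exists m.
  by move=> [x z] [y /= xy yz]; apply/GA/(Gm x y z).
have ent_nbhs : nbhs = nbhs_ ent.
  apply/funext => x; apply/seteqP; split => U.
    move=> /Gbase[n Gn]; exists (G n); first by exists n.
    by move=> y /xsectionP; exact: Gn.
  move=> [A [n _ GA] AU]; apply: filterS (Gx n x) => y Gxy.
  by apply/AU/xsectionP/GA.
pose U : uniformType := HB.pack_for uniformType T
  (Nbhs_isUniform_mixin.Build T ent_filter ent_diag ent_inv ent_split ent_nbhs).
have cU : countable_uniformity U.
  apply/countable_uniformityP; exists G => [A [n _ GA]|n]; first by exists n.
  by exists n.
exact: (@countable_uniform_metrizable R U cU hT).
Qed.

(** * Countably compact spaces and neighbourhoods of the diagonal *)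

(** If [u] takes finitely many values, one of them is taken infinitely often;
    otherwise an accumulation point of its range does the job. *)
Lemma countably_compact_cluster (T : topologicalType) (u : nat -> T) :
  countably_compact T ->
  exists x : T, forall U : set T, nbhs x U -> infinite_set [set n | U (u n)].
Proof.
move=> ccT; have [fin_u|inf_u] := pselect (finite_set (range u)).
  apply: contrapT => noclu.
  have fin_fiber x : finite_set [set n | u n = x].
    apply: contrapT => inf_x; apply: noclu; exists x => U Ux.
    by apply: sub_infinite_set inf_x => n /= ->; exact: nbhs_singleton.
  apply: infinite_nat.
  have -> : [set: nat] = \bigcup_(x in range u) [set n | u n = x].
    by apply/seteqP; split => // n _; exists (u n) => //; exists n.
  exact: bigcup_finite.
have [x x_acc] := ccT _ inf_u; exists x => U Ux fin_U.
have := x_acc U Ux; apply; apply: sub_finite_set (finite_image u fin_U).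
by move=> y [Uy [n _ unE]]; exists n => //=; rewrite unE.
Qed.

Lemma infinite_nat_ge (A : set nat) n :
  infinite_set A -> exists2 m, A m & (n <= m)%N.
Proof.
move=> Ainf; apply: contrapT => /forall2NP nA; apply: Ainf.
apply: (sub_finite_set _ (finite_II n)) => m Am /=.
by have [//|/negP] := nA m; rewrite -ltnNge.
Qed.

(** Index maps with [n <= phi n] suffice for extracting limits; unlike strictly
    increasing ones they are obtained by independent choices. *)
Lemma cvg_subseq (phi : nat -> nat) :
  (forall n, (n <= phi n)%N) -> phi @ \oo --> \oo.
Proof.
move=> phi_ge A [N _ NA]; exists N => // n /= Nn.
by apply: NA => /=; exact: leq_trans (phi_ge n).
Qed.

Section diagonal_sequence.
Context {T : topologicalType} (G : nat -> set (T * T)).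
Hypothesis ccT : countably_compact T.
Hypothesis G_diag : forall n (x : T), nbhs (x, x) (G n).
Hypothesis G_le : forall m n, (m <= n)%N -> G n `<=` G m.
Hypothesis G_base : forall x (U : set T),
  nbhs x U -> exists n, forall y, G n (x, y) -> U y.
Hypothesis G_sep : forall x y : T, x <> y -> exists n, ~ closure (G n) (x, y).

Lemma nbhs_diagonal_section (E : set (T * T)) x :
  nbhs (x, x) E -> nbhs x [set y | E (x, y)].
Proof.
move=> [[A B] /= [Ax Bx] ABE]; apply: filterS Bx => y By.
by apply: ABE; split => //; exact: nbhs_singleton.
Qed.

Lemma diagonal_sequence_hausdorff : hausdorff_space T.
Proof.
move=> x y xy; apply: contrapT => /G_sep[n]; apply => W [[A B] /= [Ax By] ABW].
have [z [Az Bz]] := xy A B Ax By; exists (z, z); split; last exact: ABW.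
exact: nbhs_singleton (G_diag n z).
Qed.

(** The sections [G n (x, _)] decrease to a neighbourhood base, so choosing the
    [n]-th term in the [n]-th section converges to a given cluster point. *)
Lemma cluster_subseq (u : nat -> T) : exists (x : T) (phi : nat -> nat),
  (forall n, (n <= phi n)%N) /\ u \o phi @ \oo --> x.
Proof.
have [x x_clu] := countably_compact_cluster u ccT.
have /choice[phi phiP] n : exists m, (n <= m)%N /\ G n (x, u m).
  have Gx := nbhs_diagonal_section (G_diag n x).
  by have [m Gm nm] := infinite_nat_ge n (x_clu _ Gx); exists m.
exists x, phi; split => [n|U /G_base[n GU]]; first by have [] := phiP n.
by exists n => // m /= nm; apply/GU/(G_le nm); have [] := phiP m.
Qed.

(** Suppose [x n], [y n], [z n] violate the conclusion for each [n].  Along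
    common indices they converge, to a single point because the closures of the
    [G n] separate distinct points.  But then [(x n, z n)] enters [E]. *)
Lemma diagonal_sequence_base (E : set (T * T)) :
  (forall x : T, nbhs (x, x) E) ->
  exists n, forall x y z, G n (x, y) -> G n (y, z) -> E (x, z).
Proof.
move=> E_diag; apply: contrapT => nE.
have /choice[p pP] n : exists p : T * T * T,
    [/\ G n (p.1.1, p.1.2), G n (p.1.2, p.2) & ~ E (p.1.1, p.2)].
  apply: contrapT => np; apply: nE; exists n => x y z xy yz.
  by apply: contrapT => xz; apply: np; exists (x, y, z).
have [a [f [f_ge fa]]] := cluster_subseq (fun n => (p n).1.1).
have [b [g [g_ge gb]]] := cluster_subseq (fun n => (p (f n)).1.2).
have [c [h [h_ge hc]]] := cluster_subseq (fun n => (p (f (g n))).2).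
pose k n := f (g (h n)).
have k_ge n : (n <= k n)%N.
  exact: leq_trans (h_ge n) (leq_trans (g_ge _) (f_ge _)).
have ka : (p (k n)).1.1 @[n --> \oo] --> a.
  apply: cvg_comp fa; apply: (@cvg_subseq (g \o h)) => n.
  exact: leq_trans (h_ge n) (g_ge _).
have kb : (p (k n)).1.2 @[n --> \oo] --> b.
  by apply: cvg_comp gb; exact: cvg_subseq.
have eq_lim (u v : nat -> T) (x y : T) : u @ \oo --> x -> v @ \oo --> y ->
    (forall n, G (k n) (u n, v n)) -> x = y.
  move=> ux vy uv; apply: contrapT => /G_sep[n].
  apply => W /(cvg_pair ux vy)[N _ NW].
  exists (u (maxn n N), v (maxn n N)); split; last exact/NW/leq_maxr.
  apply: G_le (uv _); exact: leq_trans (leq_maxl n N) (k_ge _).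
have ab : a = b by apply: eq_lim ka kb _ => n; have [] := pP (k n).
have bc : b = c by apply: eq_lim kb hc _ => n; have [] := pP (k n).
have [N _ NE] : \forall n \near \oo, E ((p (k n)).1.1, (p (k n)).2).
  by apply: (cvg_pair ka hc); rewrite -bc -ab; exact: E_diag.
by have [_ _] := pP (k N); apply; exact: NE (leqnn N).
Qed.

End diagonal_sequence.

(** The finite intersections of the [D n] form a decreasing sequence [G] of
    neighbourhoods of the diagonal; [diagonal_sequence_base] makes it a base of
    a uniformity, the inverse of [G n] being itself a neighbourhood of the
    diagonal. *)
Lemma countably_compact_metrizable (R : realType) (T : topologicalType)
    (D : nat -> set (T * T)) :
  countably_compact T ->
  (forall n (x : T), nbhs (x, x) (D n)) ->
  (forall (x : T) (U : set T), nbhs x U ->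
     exists n, forall y, D n (x, y) -> U y) ->
  (forall x y : T, x <> y -> exists n, ~ closure (D n) (x, y)) ->
  metrizable R T.
Proof.
move=> ccT D_diag D_base D_sep.
pose G n := \bigcap_(i in `I_n.+1) D i.
have GD n : G n `<=` D n by apply: bigcap_inf => /=.
have G_diag n (x : T) : nbhs (x, x) (G n).
  have D_near := @filter_forall _ 'I_n.+1 (fun i => D i) _
    (nbhs_filter (x, x)) (fun i => D_diag i x).
  apply: (@filterS _ _ (nbhs_filter (x, x))) D_near => p Dp i /= ilt.
  exact: (Dp (Ordinal ilt)).
have G_le m n : (m <= n)%N -> G n `<=` G m.
  by move=> mn xy Gxy i /= im; apply: Gxy; exact: leq_trans im _.
have G_base (x : T) (U : set T) :
    nbhs x U -> exists n, forall y, G n (x, y) -> U y.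
  by move=> /D_base[n DU]; exists n => y /GD; exact: DU.
have G_sep (x y : T) : x <> y -> exists n, ~ closure (G n) (x, y).
  by move=> /D_sep[n Dxy]; exists n => /(closure_subset (@GD n)).
have Gxx n x : G n (x, x) by exact: nbhs_singleton (G_diag n x).
have baseG := diagonal_sequence_base ccT G_diag G_le G_base G_sep.
apply: (@diagonal_sequence_metrizable R T G) => //.
- by move=> n x; exact: nbhs_diagonal_section.
- move=> n; have [x|m Gm] := baseG [set xy | G n (xy.2, xy.1)].
    have [[A B] /= [Ax Bx] ABG] := G_diag n x.
    by exists (B, A) => //= -[y z] [By Az]; exact: ABG.
  by exists m => x y xy; exact: Gm xy (Gxx _ _).
- by move=> n; exact: baseG.
- exact: diagonal_sequence_hausdorff G_diag G_sep.
Qed.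

(** * Division in rectifiable spaces *)

Section division.
Context {X : topologicalType} (e : X) (q h : X * X -> X).
Hypotheses (q_cont : continuous q) (h_cont : continuous h).
Hypothesis qxx : forall x, q (x, x) = e.
Hypothesis hxe : forall x, h (x, e) = x.
Hypothesis hq : forall x y, h (x, q (x, y)) = y.

Lemma division_eq x y : q (x, y) = e -> x = y.
Proof. by move=> qe; rewrite -[RHS](hq x) qe hxe. Qed.

(** Suppose every neighbourhood of [x] contains [y].  In [q (y, x)] one may then
    replace [x] by [y] in the second place, so [e = q (y, y)] lies in every
    neighbourhood of [q (y, x)]; starting from [e = q (x, x)] and replacing the
    first [x], [q (y, x)] lies in every neighbourhood of [e].  By T0 the points
    [q (y, x)] and [e] coincide, whence [x = y]. *)
Lemma division_accessible : kolmogorov_space X -> accessible_space X.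
Proof.
move=> T0 x y /eqP xy.
suff [U [Ux nUy]] : exists U, nbhs x U /\ ~ U y.
  exists U°; split; [exact: open_interior|exact/mem_set|].
  by apply/mem_set => /interior_subset.
apply: contrapT => nU.
have Uy U : nbhs x U -> U y.
  by move=> Ux; apply: contrapT => nUy; apply: nU; exists U.
have near_q V : nbhs (q (y, x)) V -> V e.
  move=> /q_cont[[A B] /= [/nbhs_singleton Ay /Uy By] ABV].
  by rewrite -(qxx y); exact: (ABV (y, y)).
have near_e V : nbhs e V -> V (q (y, x)).
  rewrite -(qxx x) => /q_cont[[A B] /= [/Uy Ay /nbhs_singleton Bx] ABV].
  exact: (ABV (y, x)).
have [qyx|] := eqVneq (q (y, x)) e.
  by apply: xy; rewrite (division_eq qyx).
by move=> /T0[A [[/set_mem /near_q Ae /set_mem]|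
  [/set_mem /near_e Aq /set_mem]]]; exact.
Qed.

(** The analogue of [closure V] being contained in [V * V] for a neighbourhood
    [V] of the unit of a group: if [y] is in [closure V], then some [u] in [V]
    lies in the neighbourhood of [y] formed by the [u] with [q (u, y)] in [V],
    and [y = h (u, q (u, y))]. *)
Lemma division_regular O :
  nbhs e O -> exists2 V, nbhs e V & closure V `<=` O.
Proof.
rewrite -{1}(hxe e) => /h_cont[[A B] /= [Ae Be] ABO].
exists (A `&` B); first exact: filterI.
move=> y; have : nbhs y [set u | (A `&` B) (q (u, y))].
  have : nbhs (q (y, y)) (A `&` B) by rewrite qxx; exact: filterI.
  move=> /q_cont[[C D] /= [Cy /nbhs_singleton Dy] CDAB].
  by apply: filterS Cy => u Cu; exact: (CDAB (u, y)).
move=> yAB /(_ _ yAB)[u [[Au _] [_ Bquy]]].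
by rewrite -(hq u y); exact: (ABO (u, q (u, y))).
Qed.

End division.

(** [q] is the second component of the inverse of the rectification; the inverse
    also preserves fibres, so nothing is lost by dropping the first one. *)
Lemma rectifiable_division (X : topologicalType) : rectifiable X ->
  exists (e : X) (q h : X * X -> X),
    [/\ continuous q, continuous h, forall x, q (x, x) = e,
        forall x, h (x, e) = x & forall x y, h (x, q (x, y)) = y].
Proof.
move=> [e [H [[H_cont [G [HK GK G_cont]]] Hxe H_fiber]]].
have G1 x y : (G (x, y)).1 = x.
  have : ([set x] `*` [set: X]) (x, y) by [].
  by rewrite -H_fiber => -[[a b] [/= -> _] <-]; rewrite HK.
exists e, (fun p => (G p).2), (fun p => (H p).2); split.
- by move=> p; apply: cvg_comp (G_cont p) _; exact: cvg_snd.
- by move=> p; apply: cvg_comp (H_cont p) _; exact: cvg_snd.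
- by move=> x; rewrite -Hxe HK.
- by move=> x; rewrite Hxe.
- by move=> x y; rewrite -{1}(G1 x y) -surjective_pairing GK.
Qed.

(** * Pytkeev families and fan open-tightness *)

Lemma strong_pytkeev_sequence (X : topologicalType) (x : X) :
  strong_pytkeev_at x ->
  exists N : nat -> set X, forall O A, nbhs x O -> accumulation_point A x ->
    exists k, N k `<=` O /\ infinite_set (N k `&` A).
Proof.
move=> [N [/pfcard_geP[->|/unsquash f] N_pyt]].
  by exists (fun=> set0) => O A Ox /(N_pyt O A Ox)[M []].
exists f => O A Ox /(N_pyt O A Ox)[M [NM MO MA]].
by have [k _ fk] := surj (f := f) NM; exists k; rewrite fk.
Qed.

Section pytkeev.
Context {X : topologicalType} (e : X) (N : nat -> set X).
Hypothesis X_T1 : accessible_space X.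
Hypothesis N_pyt : forall O A, nbhs e O -> accumulation_point A e ->
  exists k, N k `<=` O /\ infinite_set (N k `&` A).

(** Adding [e] ensures that points outside the preimage of such a union are not
    mapped to [e]; hence, in a T1 space, their images can come arbitrarily close
    to [e] only if they are infinitely many.  Indexing by finite lists exhibits
    the family of these unions as countable. *)
Definition pytkeev_union (s : seq nat) : set X :=
  [set y | y = e \/ exists2 k, k \in s & N k y].

Definition pytkeev_below (O : set X) n : seq nat :=
  [seq k <- iota 0 n | `[< N k `<=` O >]].

Lemma mem_pytkeev_below O n k :
  (k \in pytkeev_below O n) = (k < n)%N && `[< N k `<=` O >].
Proof. by rewrite mem_filter mem_iota add0n andbC. Qed.

Lemma pytkeev_union_below O n : O e -> pytkeev_union (pytkeev_below O n) `<=` O.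
Proof.
move=> Oe y [->//|[k]]; rewrite mem_pytkeev_below => /andP[_ /asboolP]; exact.
Qed.

Lemma pytkeev_union_below_le O m n : (m <= n)%N ->
  pytkeev_union (pytkeev_below O m) `<=` pytkeev_union (pytkeev_below O n).
Proof.
move=> mn y [->|[k km Nk]]; first by left.
right; exists k => //; move: km; rewrite !mem_pytkeev_below => /andP[km ->].
by rewrite (leq_trans km).
Qed.

(** With [Z = X], [q = id] and [X] regular this says that [X] is first countable
    at [e], the closures of finite unions being a countable base.  The map [q]
    separates the space with the Pytkeev family from the space with fan
    open-tightness. *)
Lemma fan_open_tight_closure (Z : topologicalType) (q : Z -> X) (z : Z) O :
  continuous q -> q z = e -> countable_fan_open_tightness_at z -> nbhs e O ->
  exists n, nbhs z (closure (q @^-1` pytkeev_union (pytkeev_below O n))).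
Proof.
move=> q_cont qz fan_z Oe; apply: contrapT => nbhsN.
pose C n := closure (q @^-1` pytkeev_union (pytkeev_below O n)).
have CU n y : pytkeev_union (pytkeev_below O n) (q y) -> C n y.
  by move=> ?; exact: subset_closure.
have [||F [FC F_tight]] := fan_z (fun n => ~` C n).
- by move=> n; rewrite openC; exact: closed_closure.
- move=> n B Bz; apply: contrapT => CB; apply: nbhsN; exists n.
  apply: filterS Bz => y By; apply: contrapT => nCy; apply: CB.
  by exists y.
pose A := q @` \bigcup_n F n.
have nAe : ~ A e.
  by move=> [y [n _ Fy] qy]; have [_ /(_ y Fy)] := FC n; apply; apply: CU; left.
have A_acc : accumulation_point A e.
  move=> W We finWA.
  (* In a T1 space, removing a finite set avoiding [e] from [W] leaves a
     neighbourhood of [e], whose preimage misses all the [F n]. *)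
  have : nbhs z (q @^-1` (W `\` (W `&` A))).
    apply: q_cont; rewrite qz; apply: filterI => //.
    apply: open_nbhs_nbhs; split; last by move=> [_ /nAe].
    by rewrite openC; apply: (accessible_finite_set_closed.1 X_T1).
  move=> /F_tight; apply.
  suff -> : [set n | F n `&` q @^-1` (W `\` (W `&` A)) !=set0] = set0 by [].
  rewrite -subset0 => n [y [Fy [Wqy nWA]]]; apply: nWA; split => //.
  by exists y => //; exists n.
have [k [NkO]] := N_pyt Oe A_acc; apply.
apply: (@sub_finite_set _ _ (q @` \bigcup_(n in `I_k.+1) F n)).
  move=> x [Nkx [y [n _ Fy] yE]]; exists y => //; exists n => //=.
  rewrite ltnS leqNgt; apply/negP => kn.
  have [_ /(_ y Fy)] := FC n; apply; apply: CU; right; exists k.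
    by rewrite mem_pytkeev_below kn; exact/asboolP.
  by rewrite yE.
apply: finite_image; apply: bigcup_finite => // n _.
by have [] := FC n.
Qed.

(** The [n] that [fan_open_tight_closure] provides depends on the point of the
    diagonal.  If no [n] served all points, points [x n] that [n] does not serve
    would have a cluster point; but an [n] that serves this point serves a whole
    neighbourhood of it, and so does every larger [n]. *)
Lemma countably_compact_diagonal_closure (T : topologicalType)
    (q : T * T -> X) O :
  countably_compact T -> continuous q -> (forall x, q (x, x) = e) ->
  (forall z : T * T, diagonal z -> countable_fan_open_tightness_at z) ->
  nbhs e O ->
  exists2 s, pytkeev_union s `<=` O &
    forall x : T, nbhs (x, x) (closure (q @^-1` pytkeev_union s)).
Proof.
move=> ccT q_cont qxx fan Oe.
pose C n := closure (q @^-1` pytkeev_union (pytkeev_below O n)).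
suff [n Cn] : exists n, forall x : T, nbhs (x, x) (C n).
  exists (pytkeev_below O n) => //; apply: pytkeev_union_below.
  exact: nbhs_singleton.
apply: contrapT => nC.
have /choice[u uP] n : exists x : T, ~ nbhs (x, x) (C n).
  apply: contrapT => nx; apply: nC; exists n => x; apply: contrapT => nCx.
  by apply: nx; exists x.
have [x x_clu] := countably_compact_cluster u ccT.
have fan_x : countable_fan_open_tightness_at (x, x).
  by apply: fan; exact/diagonalP.
have [n Cn] := fan_open_tight_closure q_cont (qxx x) fan_x Oe.
have Cx : nbhs x [set y | nbhs (y, y) (C n)].
  have [[A B] /= [Ax Bx] ABC] := nbhs_interior Cn.
  by apply: filterS (filterI Ax Bx) => y [Ay By]; exact: (ABC (y, y)).
have [m Cm nm] := infinite_nat_ge n (x_clu _ Cx).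
apply: (uP m); apply: filterS Cm; apply: closure_subset => y /=.
exact: pytkeev_union_below_le.
Qed.

End pytkeev.

(** * Metrizability of countably compact subspaces *)

(** The closed sets [C s], for those finite lists [s] for which [C s] is a
    neighbourhood of the diagonal, form the countable family to which
    [countably_compact_metrizable] applies. *)
Lemma rectifiable_countably_compact_metrizable (R : realType)
    (X : topologicalType) (K : set X) :
  rectifiable X -> kolmogorov_space X -> strong_pytkeev X ->
  countably_compact (set_type K) ->
  (forall z : set_type K * set_type K,
     diagonal z -> countable_fan_open_tightness_at z) ->
  metrizable R (set_type K).
Proof.
move=> /rectifiable_division[e [q [h [q_cont h_cont qxx hxe hq]]]] T0 pytX ccK.
move=> fan; have X_T1 := division_accessible q_cont qxx hxe hq T0.
have [N N_pyt] := strong_pytkeev_sequence (pytX e).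
pose qK (p : K * K) := q (\val p.1, \val p.2).
have val_cont : continuous (\val : K -> X) := @initial_continuous K X set_val.
have qK_cont : continuous qK.
  move=> p U /q_cont[[A B] /= [/val_cont Ap /val_cont Bp] ABU].
  by exists (\val @^-1` A, \val @^-1` B) => // r [Ar Br]; exact: (ABU (_, _)).
pose C s := closure (qK @^-1` pytkeev_union e N s).
pose good s := forall x : K, nbhs (x, x) (C s).
(* An enumeration of the neighbourhoods [C s]: the codes of other lists give the
   whole square. *)
pose D n := if unpickle n is Some s then [set p | good s -> C s p] else setT.
have D_inside O : nbhs e O -> exists n, closure (D n) `<=` qK @^-1` O.
  move=> /(division_regular q_cont h_cont qxx hxe hq)[V Ve VO].
  have [|s sV good_s] :=
    countably_compact_diagonal_closure X_T1 N_pyt ccK qK_cont _ fan Ve => //.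
    by move=> x; exact: qxx.
  exists (pickle s); rewrite /D pickleK => p Dp; apply: VO.
  have : C s p.
    apply: closed_closure.
    by apply: closure_subset Dp => r; exact.
  move=> Csp B /qK_cont /Csp[r [qr Br]]; exists (qK r); split => //.
  exact: sV.
refine (@countably_compact_metrizable R _ D ccK _ _ _).
- move=> n x; rewrite /D; case: unpickle => [s|]; last exact: filterT.
  have [good_s|ngood] := pselect (good s).
    by apply: filterS (good_s x) => p ? _.
  by apply: filterS filterT => p _ /ngood.
(* Sections: [y = h (x, q (x, y))] tends to [h (x, e) = x] as [q (x, y)] tends
   to [e]. *)
- move=> x U [_ [[V oV <-] Vx VU]].
  have : nbhs (\val x) V by apply: open_nbhs_nbhs.
  rewrite -{1}(hxe (\val x)) => /h_cont[[A B] /= [/nbhs_singleton Ax Be] ABV].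
  have [n DB] := D_inside _ Be; exists n => y Dxy; apply: VU.
  have := ABV (\val x, q (\val x, \val y)); rewrite /= hq; apply; split => //=.
  by apply: (DB (x, y)); exact: subset_closure.
- move=> x y xy; have /X_T1[O [oO /set_mem Oe /set_mem nOq]] : e != qK (x, y).
    apply/eqP => /esym/(division_eq hxe hq)/val_inj; exact: xy.
  have [n DO] : exists n, closure (D n) `<=` qK @^-1` O.
    by apply: D_inside; exact: open_nbhs_nbhs.
  by exists n => /DO.
Qed.

(** * Fan open-tightness of metrizable spaces *)

Lemma metrizable_countable_nbhs_base (R : realType) (T : topologicalType)
    (x : T) : metrizable R T ->
  exists2 B : nat -> set T, (forall n, nbhs x (B n)) &
    forall U, nbhs x U -> exists n, forall m, (n <= m)%N -> B m `<=` U.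
Proof.
move=> [M [f [f_cont [g [fK gK g_cont]]]]].
exists (fun n => f @^-1` ball (f x) n.+1%:R^-1%R) => [n|U Ux].
  by apply: f_cont; apply: nbhsx_ballx; rewrite invr_gt0.
have /g_cont : nbhs (g (f x)) U by rewrite fK.
move=> /nbhs_ballP[r /= r0 rU]; exists (Num.truncn r^-1) => m nm y xy.
rewrite -(fK y); apply: rU; apply: le_ball xy.
rewrite -[leRHS]invrK lef_pV2 ?posrE ?invr_gt0//.
by rewrite ltW// (lt_le_trans (truncnS_gt _))// ler_nat.
Qed.

Lemma countable_nbhs_base_fan_open_tight (T : topologicalType) (z : T)
    (B : nat -> set T) :
  (forall n, nbhs z (B n)) ->
  (forall U, nbhs z U -> exists n, forall m, (n <= m)%N -> B m `<=` U) ->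
  countable_fan_open_tightness_at z.
Proof.
move=> Bz B_base A oA Az.
have /choice[a aP] n : exists a, A n a /\ B n a by exact: Az n _ (Bz n).
exists (fun n => [set a n]); split => [n|U /B_base[n BU]].
  by split => // _ ->; have [] := aP n.
apply: (@sub_infinite_set _ (~` `I_n)).
  move=> m /negP; rewrite -leqNgt => nm; exists (a m); split => //.
  by apply: (BU m nm); have [] := aP m.
apply: cofinite_set_infinite; first exact: infinite_nat.
by rewrite setCK; exact: finite_II.
Qed.

Theorem theorem6p4 (R : realType) (X : topologicalType) (K : set X) :
  rectifiable X -> kolmogorov_space X -> strong_pytkeev X ->
  countably_compact (set_type K) ->
  (metrizable R (set_type K) <->
   forall z : set_type K * set_type K,
     diagonal z -> countable_fan_open_tightness_at z).
Proof.
move=> rectX T0 pytX ccK; split; last first.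
  exact: rectifiable_countably_compact_metrizable.
move=> metK [x y] _.
have [B Bx B_base] := metrizable_countable_nbhs_base x metK.
have [C Cy C_base] := metrizable_countable_nbhs_base y metK.
apply: (@countable_nbhs_base_fan_open_tight _ _ (fun n => B n `*` C n)).
  by move=> n; exists (B n, C n) => //; split; [exact: Bx|exact: Cy].
move=> U [[V W] /= [/B_base[n BV] /C_base[m CW]] VWU].
exists (maxn n m) => k; rewrite geq_max => /andP[nk mk] -[a b] [/= Ba Cb].
by apply: VWU; split; [exact: BV Ba|exact: CW Cb].
Qed.
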